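(* Fix $\alpha,\beta>0$. For $n\ge3$ let $S$ be a random $\alpha/\beta$-staircase tableau of size $n$ with law $\mathbb{P}_{n,\alpha,\beta}$, and let $X_n^{(3)}$ be the number of non-empty boxes among the boxes $(n-j-1,j)$, $1\le j\le n-2$ (the third main diagonal). Then, as $n\to\infty$, $X_n^{(3)}$ converges in distribution to a Poisson random variable with parameter $1$.
   Context: A staircase tableau of size $n$ has boxes $(i,j)$ with $i,j\ge1$ and $i+j\le n+1$, rows numbered from the top and columns from the left. An $\alpha/\beta$-staircase tableau of size $n$ is a filling in which each box is empty or contains $\alpha$ or $\beta$, such that: all boxes in the same column and above an $\alpha$ are empty; all boxes in the same row and to the left of a $\beta$ are empty; every main-diagonal box (with $i+j=n+1$) contains a symbol. $\overline{\mathcal{S}}_n$ is the set of these. The weight is $wt(S)=\alpha^{N_\alpha}\beta^{N_\beta}$ ($N_\alpha,N_\beta$ the numbers of $\alpha$'s, $\beta$'s), and $\mathbb{P}_{n,\alpha,\beta}(S)=wt(S)/\sum_{T\in\overline{\mathcal{S}}_n}wt(T)$. *)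

(* Defs.v *)
From HB Require Import structures.
From mathcomp Require Import all_boot all_order all_algebra.
From mathcomp Require Import all_classical all_reals all_analysis.
Set Implicit Arguments. Unset Strict Implicit. Unset Printing Implicit Defensive.
Import Order.TTheory GRing.Theory Num.Theory.
Local Open Scope ring_scope.

(* Boxes are encoded 0-based: the paper's box (i,j) (1-based) is the pair
   (i-1, j-1) : 'I_n * 'I_n.  The paper's box (i,j) lies in the staircase of
   size n iff i + j <= n + 1, i.e. (i-1) + (j-1) < n.
   Contents: None = empty, Some true = alpha, Some false = beta. *)
Definition filling (n : nat) := {ffun 'I_n * 'I_n -> option bool}.

Definition in_stair (n : nat) (b : 'I_n * 'I_n) : bool := (b.1 + b.2 < n)%N.

Definition is_ab_staircase (n : nat) (S : filling n) : bool :=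
  [&& (* boxes outside the staircase carry no symbol (canonical encoding) *)
      [forall b : 'I_n * 'I_n, (~~ in_stair b) ==> (S b == None)],
      [forall b : 'I_n * 'I_n, (S b == Some true) ==>
         [forall i : 'I_n, (i < b.1)%N ==> (S (i, b.2) == None)]],
      [forall b : 'I_n * 'I_n, (S b == Some false) ==>
         [forall j : 'I_n, (j < b.2)%N ==> (S (b.1, j) == None)]] &
      (* every main-diagonal box (paper: i + j = n + 1) contains a symbol *)
      [forall b : 'I_n * 'I_n, ((b.1 + b.2).+1 == n) ==> (S b != None)]].

Definition staircases (n : nat) : {set filling n} :=
  [set S : filling n | is_ab_staircase S].

Definition N_alpha (n : nat) (S : filling n) : nat :=
  #|[set b : 'I_n * 'I_n | S b == Some true]|.
Definition N_beta (n : nat) (S : filling n) : nat :=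
  #|[set b : 'I_n * 'I_n | S b == Some false]|.

Definition wt (R : numFieldType) (a b : R) (n : nat) (S : filling n) : R :=
  a ^+ N_alpha S * b ^+ N_beta S.

Definition prob (R : numFieldType) (a b : R) (n : nat) (S : filling n) : R :=
  wt a b S / \sum_(T in staircases n) wt a b T.

(* X_n^(3): number of non-empty boxes on the third main diagonal, i.e. the
   paper's boxes (n-j-1, j), 1 <= j <= n-2 (1-based i + j = n - 1), which are
   the 0-based pairs (i', j') with i' + j' + 3 = n. *)
Definition X3 (n : nat) (S : filling n) : nat :=
  #|[set b : 'I_n * 'I_n | (b.1 + b.2 + 3 == n)%N && (S b != None)]|.

Definition cdf_X3 (R : numFieldType) (a b : R) (k n : nat) : R :=
  \sum_(S in staircases n | (X3 S <= k)%N) prob a b S.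

(* Main.v *)
(* Weight every row containing no beta by x, and write C f(x) = (a x + b) f(x + b).
   Removing the left column of a tableau expresses the generating function of
   wt(S) y^X3(S) times the row weights by generating functions of smaller
   tableaux, in which the two lowest rows carry weights v, u of their own; these
   functions depend affinely on u and on v. Eliminating u and v leaves, with
   c = a b and w = y - 1,
     G_n = C G_(n-1) + c w (C^2 + c C) G_(n-3) + c^2 w^2 C^2 G_(n-4).
   The coefficient of w^m, divided by the total weight, is the binomial moment
   E[binom(X3, m)]; it obeys a recurrence with positive coefficients, which
   yields matching upper and lower bounds, so it tends to 1/m!. The Bonferroni
   inequalities turn this into convergence of the point probabilities to those
   of the Poisson(1) law. *)
Require Import Defs.
From HB Require Import structures.
From mathcomp Require Import all_boot all_order all_algebra.
From mathcomp Require Import all_classical all_reals all_analysis.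
From mathcomp Require Import ring lra zify.
Import Order.TTheory GRing.Theory Num.Theory.
Import numFieldNormedType.Exports.
Set Implicit Arguments. Unset Strict Implicit. Unset Printing Implicit Defensive.
Local Open Scope classical_set_scope.
Local Open Scope ring_scope.

(** * Removing the left column *)

Lemma staircaseP n (S : filling n) : reflect
  [/\ forall i j : 'I_n, (n <= i + j)%N -> S (i, j) = None,
      forall i j k : 'I_n, S (i, j) = Some true -> (k < i)%N -> S (k, j) = None,
      forall i j k : 'I_n, S (i, j) = Some false -> (k < j)%N -> S (i, k) = None &
      forall i j : 'I_n, (i + j).+1 = n -> S (i, j) <> None]
  (S \in staircases n).
Proof.
rewrite inE; apply: (iffP and4P) => [[/forallP H1 /forallP H2 /forallP H3 /forallP H4]|[H1 H2 H3 H4]]; split.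
- by move=> i j nij; apply/eqP/(implyP (H1 (i, j))); rewrite /in_stair -leqNgt.
- move=> i j k Sij ki; have /implyP/(_ _)/forallP/(_ k)/implyP/(_ ki)/eqP := H2 (i, j).
  by apply; apply/eqP.
- move=> i j k Sij kj; have /implyP/(_ _)/forallP/(_ k)/implyP/(_ kj)/eqP := H3 (i, j).
  by apply; apply/eqP.
- by move=> i j /eqP ij; apply/eqP/(implyP (H4 (i, j))).
- by apply/forallP => -[i j]; apply/implyP; rewrite -leqNgt /= => /H1 ->.
- apply/forallP => -[i j]; apply/implyP => /eqP Sij; apply/forallP => k.
  by apply/implyP => ki; apply/eqP/(H2 i).
- apply/forallP => -[i j]; apply/implyP => /eqP Sij; apply/forallP => k.
  by apply/implyP => ki; apply/eqP/(H3 i j).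
- by apply/forallP => -[i j]; apply/implyP => /eqP ij; apply/eqP/H4.
Qed.

(** The last row of a staircase of size [n.+1] has a single box, in column [ord0]; its other entries
    lie outside the staircase and get the canonical [None]. *)
Definition glue n (T : filling n) (c : {ffun 'I_n.+1 -> option bool}) :
    filling n.+1 :=
  [ffun b => if unlift ord0 b.2 is Some j then
               if unlift ord_max b.1 is Some i then T (i, j) else None
             else c b.1].

Definition beta_free n (S : filling n) (i : 'I_n) :=
  [forall j, S (i, j) != Some false].

Definition alpha_topmost m (c : {ffun 'I_m -> option bool}) :=
  [forall i, (c i == Some true) ==> [forall k : 'I_m, (k < i)%N ==> (c k == None)]].

Definition column_ok n (T : filling n) (c : {ffun 'I_n.+1 -> option bool}) :=
  [&& alpha_topmost c, c ord_max != None &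
      [forall i, (c (lift ord_max i) != None) ==> beta_free T i]].

Lemma glue0 n (T : filling n) c i : glue T c (i, ord0) = c i.
Proof. by rewrite ffunE /= unlift_none. Qed.

Lemma glue_lift n (T : filling n) c i j :
  glue T c (lift ord_max i, lift ord0 j) = T (i, j).
Proof. by rewrite ffunE /= !liftK. Qed.

Lemma glue_max n (T : filling n) c j : glue T c (ord_max, lift ord0 j) = None.
Proof. by rewrite ffunE /= liftK unlift_none. Qed.

Lemma alpha_topmostP m (c : {ffun 'I_m -> option bool}) : reflect
  (forall i k : 'I_m, c i = Some true -> (k < i)%N -> c k = None) (alpha_topmost c).
Proof.
apply: (iffP forallP) => [H i k ci ki|H i].
  by move: (H i); rewrite ci eqxx => /forallP/(_ k)/implyP/(_ ki)/eqP.
by apply/implyP => /eqP ci; apply/forallP => k; apply/implyP => /(H i k ci) ->.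
Qed.

(** The new column is leftmost, so it interacts with [T] only through betas, which force the new box
    of their row to be empty. The only new diagonal box is the bottom one. *)
Lemma glue_staircase n (T : filling n) c :
  (glue T c \in staircases n.+1) = (T \in staircases n) && column_ok T c.
Proof.
apply/staircaseP/andP => [[H1 H2 H3 H4]|[/staircaseP[H1 H2 H3 H4]]].
- split.
  + apply/staircaseP; split.
    * move=> i j ij; rewrite -(glue_lift T c); apply: H1.
      by rewrite lift_max lift0 addnS ltnS.
    * move=> i j k; rewrite -!(glue_lift T c) => Sij ki; apply: H2 Sij _.
      by rewrite !lift_max.
    * move=> i j k; rewrite -!(glue_lift T c) => Sij kj; apply: H3 Sij _.
      by rewrite !lift0 ltnS.
    * move=> i j ij; rewrite -(glue_lift T c); apply: H4.
      by rewrite lift_max lift0 addnS ij.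
  + apply/and3P; split.
    * by apply/alpha_topmostP => i k; rewrite -(glue0 T c i) -(glue0 T c k); apply: H2.
    * apply/eqP; rewrite -(glue0 T c); apply: H4; by rewrite /= addn0.
    * apply/forallP => i; apply/implyP => ci; apply/forallP => j.
      apply: contra ci => /eqP; rewrite -(glue_lift T c) => Sij.
      by rewrite -(glue0 T c) (H3 _ _ _ Sij) // lift0.
- case/and3P => /alpha_topmostP C1 C2 /forallP C3; split.
  + move=> i j; case: (unliftP ord0 j) => [j'|] ->; last first.
      by rewrite addn0 leqNgt ltn_ord.
    case: (unliftP ord_max i) => [i'|] ->; last by rewrite glue_max.
    by rewrite lift_max lift0 addnS ltnS glue_lift => /H1.
  + move=> i j k; case: (unliftP ord0 j) => [j'|] ->; last first.
      by rewrite !glue0; apply: C1.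
    case: (unliftP ord_max i) => [i'|] ->; last by rewrite glue_max.
    case: (unliftP ord_max k) => [k'|] ->; last by rewrite glue_max.
    by rewrite !glue_lift !lift_max; apply: H2.
  + move=> i j k; case: (unliftP ord0 j) => [j'|] -> //.
    case: (unliftP ord_max i) => [i'|] ->; last by rewrite glue_max.
    rewrite glue_lift => Tf; case: (unliftP ord0 k) => [k'|] ->.
      by rewrite !glue_lift !lift0 ltnS; apply: H3.
    move=> _; rewrite glue0; apply/eqP; apply/negPn/negP => /(implyP (C3 i')).
    by move/forallP/(_ j'); rewrite Tf eqxx.
  + move=> i j; case: (unliftP ord0 j) => [j'|] ->.
      case: (unliftP ord_max i) => [i'|] ->; last by move=> /eqP; rewrite lift0 addnS /= !eqSS eqn_leq ltnNge leq_addr.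
      by rewrite glue_lift lift_max lift0 addnS => -[]; apply: H4.
    rewrite glue0 addn0 => -[ij]; have ->: i = ord_max by apply: val_inj.
    by apply/eqP.
Qed.

Lemma beta_free_glue n (T : filling n) c i :
  beta_free (glue T c) (lift ord_max i)
  = beta_free T i && (c (lift ord_max i) != Some false).
Proof.
apply/forallP/andP => [H|[/forallP H ci] j].
  split; last by rewrite -(glue0 T).
  by apply/forallP => j; rewrite -(glue_lift T c).
by case: (unliftP ord0 j) => [j'|] ->; rewrite ?glue_lift ?glue0.
Qed.

Lemma beta_free_glue_max n (T : filling n) c :
  beta_free (glue T c) ord_max = (c ord_max != Some false).
Proof.
apply/forallP/idP => [/(_ ord0)|H j]; first by rewrite glue0.
by case: (unliftP ord0 j) => [j'|] ->; rewrite ?glue_max ?glue0.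
Qed.

(** * Sums over columns *)

Definition column_sum (K : comNzRingType) m (W : 'I_m -> option bool -> K) : K :=
  \sum_(c : {ffun 'I_m -> option bool} | alpha_topmost c) \prod_i W i (c i).

Lemma sum_option_bool (V : nmodType) (F : option bool -> V) :
  \sum_o F o = F None + F (Some true) + F (Some false).
Proof.
rewrite (bigD1 None) //= (bigD1 (Some true)) //= (bigD1 (Some false)) //=.
by rewrite big1 ?addr0 ?addrA // => -[[]|].
Qed.

Definition extend_column m (c : {ffun 'I_m -> option bool}) o :
    {ffun 'I_m.+1 -> option bool} :=
  [ffun i => if unlift ord_max i is Some j then c j else o].

Lemma extend_lift m (c : {ffun 'I_m -> option bool}) o i :
  extend_column c o (lift ord_max i) = c i.
Proof. by rewrite ffunE liftK. Qed.

Lemma extend_max m (c : {ffun 'I_m -> option bool}) o :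
  extend_column c o ord_max = o.
Proof. by rewrite ffunE unlift_none. Qed.

Lemma alpha_topmost_extend m (c : {ffun 'I_m -> option bool}) o :
  alpha_topmost (extend_column c o) =
  alpha_topmost c && ((o == Some true) ==> (c == [ffun=> None])).
Proof.
apply/alpha_topmostP/andP => [H|[/alpha_topmostP H /implyP Ho] i k].
  split.
    apply/alpha_topmostP => i k; rewrite -(extend_lift c o i) -(extend_lift c o k).
    by move=> ci ki; apply: H ci _; rewrite !lift_max.
  apply/implyP => /eqP oE; apply/eqP/ffunP => i; rewrite ffunE -(extend_lift c o).
  by apply: (H ord_max); rewrite ?extend_max // lift_max ltn_ord.
case: (unliftP ord_max i) => [i'|] ->; case: (unliftP ord_max k) => [k'|] ->.
- by rewrite !extend_lift !lift_max; apply: H.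
- by rewrite lift_max ltnNge /= (ltnW (ltn_ord _)).
- by rewrite extend_max extend_lift => /eqP /Ho /eqP ->; rewrite ffunE.
- by rewrite ltnn.
Qed.

(** An alpha in the last box empties everything above it; [None] or a beta leaves the rest of the
    column free. *)
Lemma column_sum_recr (K : comNzRingType) m (W : 'I_m.+1 -> option bool -> K) :
  column_sum W =
  column_sum (fun i => W (lift ord_max i)) * (W ord_max None + W ord_max (Some false))
  + (\prod_i W (lift ord_max i) None) * W ord_max (Some true).
Proof.
rewrite /column_sum.
rewrite (reindex_onto (fun p => extend_column p.1 p.2)
   (fun c : {ffun 'I_m.+1 -> _} => ([ffun i => c (lift ord_max i)], c ord_max))) /=; last first.
  move=> c _; apply/ffunP => i; rewrite ffunE.
  by case: (unliftP ord_max i) => [i'|] -> //; rewrite ffunE.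
rewrite (eq_bigl (fun p => true && (alpha_topmost p.1 &&
    ((p.2 == Some true) ==> (p.1 == [ffun=> None]))))); last first.
  move=> [c o] /=; rewrite alpha_topmost_extend extend_max -[RHS]andbT.
  congr (_ && _); apply/eqP; congr (_, _); apply/ffunP => i.
  by rewrite ffunE extend_lift.
rewrite -(pair_big_dep predT (fun c o => alpha_topmost c &&
    ((o == Some true) ==> (c == [ffun=> None])))
    (fun c o => \prod_i W i (extend_column c o i))) /=.
pose P c := \prod_i W (lift ord_max i) (c i) : K.
have prodE (c : {ffun 'I_m -> option bool}) o :
    \prod_i W i (extend_column c o i) = P c * W ord_max o.
  rewrite (bigD1_ord ord_max) //= extend_max mulrC; congr (_ * _).
  by apply: eq_bigr => i _; rewrite extend_lift.
transitivity (\sum_(c : {ffun 'I_m -> option bool})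
   ((if alpha_topmost c then P c else 0) * (W ord_max None + W ord_max (Some false))
   + (if c == [ffun=> None] then P c * W ord_max (Some true) else 0))).
  apply: eq_bigr => c _; rewrite big_mkcond sum_option_bool /= !prodE.
  case: (eqVneq c [ffun=> None]) => [->|_].
    have -> : alpha_topmost ([ffun=> None] : {ffun 'I_m -> _}).
      by apply/alpha_topmostP => i k; rewrite ffunE.
    by rewrite /=; ring.
  by case: alpha_topmost => /=; ring.
rewrite big_split /= -mulr_suml -big_mkcond /= -[in LHS]big_mkcond /= big_pred1_eq.
congr (_ + _ * _); by apply: eq_bigr => i _; rewrite ffunE.
Qed.

Lemma column_sum0 (K : comNzRingType) (W : 'I_0 -> option bool -> K) : column_sum W = 1.
Proof.
rewrite /column_sum (big_pred1 [ffun=> None]) ?big_ord0 // => c /=.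
have -> : c = [ffun=> None] by apply/ffunP => -[].
by rewrite eqxx; apply/alpha_topmostP => -[].
Qed.

(* If every [alpha]-weight is proportional to the increment [b * A = g * B],
   the sum over the position of the [alpha] telescopes. *)
Lemma column_sum_uniform (K : comNzRingType) (b g : K) m (W : 'I_m -> option bool -> K) :
  (forall i, b * W i (Some true) = g * W i (Some false)) ->
  b * column_sum W = (b + g) * (\prod_i (W i None + W i (Some false)))
                     - g * \prod_i W i None.
Proof.
elim: m W => [|m IH] W H; first by rewrite column_sum0 !big_ord0; ring.
rewrite column_sum_recr mulrDr mulrA IH => [|i]; last exact: H.
rewrite mulrCA H !(bigD1_ord (n := m.+1) ord_max) //=.
by ring.
Qed.

(** The telescoping persists when the last entry has its own ratio [h]: only the column whose sole
    symbol is an alpha in the last box is affected. *)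
Lemma column_sum_last (K : comNzRingType) (b g h : K) m
    (W : 'I_m.+1 -> option bool -> K) :
  (forall i, b * W (lift ord_max i) (Some true) = g * W (lift ord_max i) (Some false)) ->
  b * W ord_max (Some true) = h * W ord_max (Some false) ->
  b * column_sum W = (b + g) * (\prod_i (W i None + W i (Some false)))
     - g * \prod_i W i None
     + (h - g) * (\prod_i W (lift ord_max i) None) * W ord_max (Some false).
Proof.
move=> H Hm; rewrite column_sum_recr mulrDr mulrA (column_sum_uniform H).
rewrite mulrCA Hm !(bigD1_ord (n := m.+1) ord_max) //=.
by ring.
Qed.

(** * Generating functions *)

Section GeneratingFunction.
Variables (K : comNzRingType) (a b y : K).

Definition box_weight (n i j : nat) (o : option bool) : K :=
  if o is Some s then
    (if s then a else b) * (if (i + j + 3 == n)%N then y else 1)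
  else 1.

Definition tableau_weight n (S : filling n) : K :=
  \prod_(i < n) \prod_(j < n) box_weight n i j (S (i, j)).

(* Rows are weighted according to their distance [n - i.+1] to the bottom, so
   that removing the left column and its bottom box shifts [r] by one. *)
Definition row_weight n (r : nat -> K) (S : filling n) : K :=
  \prod_(i < n) (if beta_free S i then r (n - i.+1)%N else 1).

Definition gf n (r : nat -> K) : K :=
  \sum_(S in staircases n) tableau_weight S * row_weight r S.

(* Entries that are not allowed have weight [0], so that among the validity
   conditions on a column only [alpha_topmost] remains to be imposed. *)
Definition left_weight n (r : nat -> K) (T : filling n) (i : 'I_n) (o : option bool) : K :=
  if beta_free T i then
    let z := if (i.+2 == n)%N then y else 1 in
    match o with
    | None => r (n - i)%N
    | Some true => a * z * r (n - i)%N
    | Some false => b * z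
    end
  else (o == None)%:R.

Definition bottom_weight (r : nat -> K) (o : option bool) : K :=
  match o with None => 0 | Some true => a * r 0 | Some false => b end.

Definition column_weight n (r : nat -> K) (T : filling n) (i : 'I_n.+1) (o : option bool) : K :=
  if unlift ord_max i is Some i' then left_weight r T i' o else bottom_weight r o.

Lemma tableau_weight_glue n (T : filling n) c :
  tableau_weight (glue T c) =
  tableau_weight T * \prod_(i < n.+1) box_weight n.+1 i 0 (c i).
Proof.
rewrite /tableau_weight.
under eq_bigr => i _ do rewrite (bigD1_ord ord0) //= glue0.
rewrite big_split /= mulrC; congr (_ * _).
rewrite (bigD1_ord ord_max) //= [X in X * _]big1 ?mul1r => [|j _]; last first.
  by rewrite glue_max.
apply: eq_bigr => i _; apply: eq_bigr => j _.
by rewrite glue_lift /box_weight /= /bump /= leqNgt ltn_ord add0n add1n !addnS addSn eqSS.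
Qed.

(** Row by row: a row of [T] with a beta forces an empty box and has row weight 1; a [beta_free] row
    keeps its factor [r] unless the new box holds a beta. *)
Lemma glue_weight n (r : nat -> K) (T : filling n) c :
  column_ok T c ->
  (\prod_(i < n.+1) box_weight n.+1 i 0 (c i)) * row_weight r (glue T c)
  = \prod_(i < n.+1) column_weight r T i (c i).
Proof.
case/and3P => _ c_max /forallP c_free.
rewrite /row_weight -big_split /= !(bigD1_ord (n := n.+1) ord_max) //=.
congr (_ * _).
  rewrite beta_free_glue_max /column_weight unlift_none subnn.
  have nE : (n + 0 + 3 == n.+1)%N = false by lia.
  by case: (c ord_max) c_max => [[]|] //= _; rewrite nE /=; ring.
apply: eq_bigr => i _; rewrite beta_free_glue /column_weight liftK /left_weight.
have := c_free i; rewrite /bump leqNgt ltn_ord /= add0n subSS => /implyP ci.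
rewrite /box_weight; have -> : (i + 0 + 3 == n.+1)%N = (i.+2 == n)%N by lia.
case: (c _) ci => [[]|] /= => [->|->|_] //=; rewrite ?mulr1 ?andbT ?mul1r //.
Qed.

Lemma column_weight0 n (r : nat -> K) (T : filling n) (c : {ffun 'I_n.+1 -> option bool}) :
  alpha_topmost c -> ~~ column_ok T c ->
  \prod_(i < n.+1) column_weight r T i (c i) = 0.
Proof.
rewrite /column_ok => -> /=; rewrite negb_and negbK => /orP[/eqP cE|].
  by rewrite (bigD1 ord_max) //= cE /column_weight unlift_none /= mul0r.
rewrite negb_forall => /existsP[i]; rewrite negb_imply => /andP[ci /negPf Ti].
rewrite (bigD1 (lift ord_max i)) //= /column_weight liftK /left_weight Ti.
by rewrite (negPf ci) mul0r.
Qed.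

Lemma gf_recl n (r : nat -> K) :
  gf n.+1 r = \sum_(T in staircases n) tableau_weight T * column_sum (column_weight r T).
Proof.
rewrite /gf (reindex_onto (fun p => glue p.1 p.2)
  (fun S : filling n.+1 => ([ffun b => S (lift ord_max b.1, lift ord0 b.2)],
                   [ffun i => S (i, ord0)]))) /=; last first.
  move=> S /staircaseP[S0 _ _ _]; apply/ffunP => -[i j]; rewrite ffunE /=.
  case: (unliftP ord0 j) => [j'|] ->; last by rewrite ffunE.
  case: (unliftP ord_max i) => [i'|] ->; first by rewrite ffunE.
  by rewrite S0 //= addnS ltnS leq_addr.
rewrite (eq_bigl (fun p => (p.1 \in staircases n) && column_ok p.1 p.2)); last first.
  move=> [T c] /=; rewrite glue_staircase -[RHS]andbT; congr (_ && _).
  apply/eqP; congr (_, _); apply/ffunP => x; rewrite ffunE ?glue0 //.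
  by rewrite glue_lift; case: x.
rewrite -(pair_big_dep (mem (staircases n)) (fun T c => column_ok T c)
    (fun T c => tableau_weight (glue T c) * row_weight r (glue T c))) /=.
apply: eq_bigr => T _; rewrite /column_sum mulr_sumr.
rewrite [RHS](bigID (column_ok T)) /= [X in _ + X]big1 ?addr0; last first.
  by move=> c /andP[c1 c2]; rewrite column_weight0 // mulr0.
apply: eq_big => [c|c c_ok]; first by rewrite /column_ok; case: alpha_topmost.
by rewrite tableau_weight_glue -mulrA glue_weight.
Qed.

(** This family is closed under removal of the left column: the box carrying [y] perturbs the row at
    distance 1 of the smaller tableau, and an earlier perturbation moves from distance 1 to 0. *)
Definition rows3 (x u v : K) (d : nat) : K :=
  match d with 0 => v | 1 => u | _ => x end.

Definition gf3 n x u v := gf n (rows3 x u v).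

(** This is [column_sum_last] with [g = a * x] and [h = a * u]; the factor [y] multiplies both
    symbols of its box, so it leaves the ratios alone. The last difference is [b] times the weight
    of the other rows if the bottom row of [T] is beta-free, and 0 otherwise. *)
Lemma left_column_sum n x u v (T : filling n) :
  b * column_sum (left_weight (rows3 x u v) T) =
  (a * x + b) * row_weight (rows3 (x + b) (x + b * y) (u + b)) T
  - a * x * row_weight (rows3 x x u) T
  + a * (u - x) * (row_weight (rows3 x x (u + b)) T - row_weight (rows3 x x u) T).
Proof.
(* Rows of [T] are one step farther from the bottom in the larger tableau, so [rows3 x u v] reads
   there as [rows3 x x u]. *)
have low (i : 'I_n) o :
    left_weight (rows3 x u v) T i o =
    if beta_free T i then
    match o with
    | None => rows3 x x u (n - i.+1)
    | Some true => a * (if (i.+2 == n)%N then y else 1) * rows3 x x u (n - i.+1)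
    | Some false => b * (if (i.+2 == n)%N then y else 1)
    end else (o == None)%:R.
  rewrite /left_weight; case: beta_free => //.
  have -> : (n - i = (n - i.+1).+1)%N by have := ltn_ord i; lia.
  by case: (n - i.+1)%N => [|[|k]].
have rowN : row_weight (rows3 x x u) T = \prod_i left_weight (rows3 x u v) T i None.
  by apply: eq_bigr => i _; rewrite low; case: beta_free.
have rowD : row_weight (rows3 (x + b) (x + b * y) (u + b)) T =
    \prod_i (left_weight (rows3 x u v) T i None + left_weight (rows3 x u v) T i (Some false)).
  apply: eq_bigr => i _; rewrite !low; case: beta_free; last by rewrite /= addr0.
  have -> : (i.+2 == n) = (n - i.+1 == 1)%N by have := ltn_ord i; lia.
  by case: (n - i.+1)%N => [|[|k]] /=; rewrite ?mulr1.
rewrite rowD rowN; case: n T low rowN rowD => [|n] T low rowN rowD.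
  rewrite column_sum0 !big_ord0 /row_weight !big_ord0; ring.
rewrite (column_sum_last (g := a * x) (h := a * u)).
- rewrite -rowN /row_weight !(bigD1_ord (n := n.+1) ord_max) //=.
  rewrite subnn /= ![left_weight _ T ord_max (Some false)]low /=.
  have -> : (n.+2 == n.+1) = false by lia.
  have E z : \prod_(i < n) (if beta_free T (lift ord_max i)
      then rows3 x x z (n.+1 - (bump n i).+1) else 1)
      = \prod_i left_weight (rows3 x u v) T (lift ord_max i) None.
    apply: eq_bigr => i _; rewrite low /= /bump leqNgt ltn_ord /= add0n subSS.
    case: beta_free => //.
    have -> : (n - i = (n - i.+1).+1)%N by have := ltn_ord i; lia.
    by case: (n - i.+1)%N.
  rewrite !E; case: beta_free => /=; ring.
- move=> i; rewrite !low; case: beta_free => /=; last by ring.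
  rewrite /bump leqNgt ltn_ord /= add0n subSS.
  have -> : (n - i = (n - i.+1).+1)%N by have := ltn_ord i; lia.
  by case: (n - i.+1)%N => [|k] /=; ring.
- rewrite !low; case: beta_free => /=; last by ring.
  by rewrite subnn /=; ring.
Qed.

Lemma gf3_0 x u v : gf3 0 x u v = 1.
Proof.
rewrite /gf3 /gf (big_pred1 [ffun=> None]) => [|S /=].
  by rewrite /tableau_weight /row_weight !big_ord0 mulr1.
have -> : S = [ffun=> None] by apply/ffunP => -[[]].
by rewrite eqxx; apply/staircaseP; split => -[].
Qed.

(** A beta in the bottom box supplies the factor [b] of [left_column_sum]; an alpha empties the
    column above it, and its [a * v] merges with [- a * x]. *)
Lemma gf3_recl n x u v :
  gf3 n.+1 x u v = a * (v - x) * gf3 n x x u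
    + (a * x + b) * gf3 n (x + b) (x + b * y) (u + b)
    + a * (u - x) * (gf3 n x x (u + b) - gf3 n x x u).
Proof.
rewrite /gf3 gf_recl /gf -sumrB !mulr_sumr -!big_split /=.
apply: eq_bigr => T _; rewrite column_sum_recr.
have liftE i : column_weight (rows3 x u v) T (lift ord_max i) = left_weight (rows3 x u v) T i.
  by rewrite /column_weight liftK.
rewrite (_ : column_sum _ = column_sum (left_weight (rows3 x u v) T)); last first.
  by apply: eq_bigr => c _; apply: eq_bigr => i _; rewrite liftE.
rewrite /column_weight !unlift_none /= add0r mulrDr [_ * b]mulrC left_column_sum.
rewrite (_ : \prod_i _ = row_weight (rows3 x x u) T); first by ring.
apply: eq_bigr => i _; rewrite liftK /left_weight; case: beta_free => //.
have -> : (n - i = (n - i.+1).+1)%N by have := ltn_ord i; lia.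
by case: (n - i.+1)%N => [|[|k]].
Qed.
End GeneratingFunction.

(** * The recurrence *)

Section Recurrence.
Variables (K : comNzRingType) (a b y : K).
Let w := y - 1.
Local Notation gf3 := (gf3 a b y).

(** The value 0 for [n < k] lets one recurrence hold from the smallest sizes on. *)
Definition lagged (G : nat -> K -> K) (k n : nat) (x : K) : K :=
  if (k <= n)%N then G (n - k)%N x else 0.

Definition gf1 n x := gf3 n x x x.
Local Notation lag := (lagged gf1).

Lemma gf3_last n x v : gf3 n x x v = gf1 n x + a * (v - x) * lag 1 n x.
Proof.
case: n => [|n]; first by rewrite /gf1 !gf3_0 /lagged /=; ring.
by rewrite /gf1 !gf3_recl /lagged /= subSS subn0 /gf1; ring.
Qed.

(** In [gf3_recl] the slope in [v] is [a] times a function with equal upper weights, which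
    [gf3_last] expands in turn. *)
Lemma gf3_affine n x u v :
  gf3 n x u v = gf3 n x u x + a * (v - x) * (lag 1 n x + a * (u - x) * lag 2 n x).
Proof.
case: n => [|n]; first by rewrite !gf3_0 /lagged /=; ring.
rewrite !(gf3_recl _ _ _ n) !(gf3_last n) /lagged !ltnS !subSS subn0.
rewrite leq0n.
by ring.
Qed.

Lemma gf1_recl n x :
  gf1 n.+1 x = (a * x + b) *
    (gf1 n (x + b)
     + (a * (x + b) + b) * (a * b * w) *
         (lag 2 n (x + b + b) + a * b * w * lag 3 n (x + b + b))
     + (a * b) ^+ 2 * w * lag 2 n (x + b)).
Proof.
have step k t : gf1 k.+1 t = (a * t + b) * gf3 k (t + b) (t + b * y) (t + b).
  by rewrite {1}/gf1 gf3_recl; ring.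
rewrite step; congr (_ * _); case: n => [|n].
  by rewrite /gf1 !gf3_0 /lagged /=; ring.
(* Both sides now contain [gf3 n] at weights differing only in the bottom row, by [b * w];
   [gf3_affine] makes the common term cancel. *)
rewrite step gf3_recl (gf3_affine n (x + b + b) _ (x + b * y + b)) !gf3_last /w.
rewrite /lagged !ltnS !subSS.
by ring.
Qed.

End Recurrence.

(** * Coefficients in powers of [w] *)

Section Moments.
Variables (R : fieldType) (a b : R).
Local Notation G := (gf1 a%:P b%:P (1 + 'X)).

(** Setting [y = 1 + 'X] makes the indeterminate equal to [w], so this coefficient collects the
    factors ['C(X3 S, m)]. *)
Definition moment_gf n m x : R := (G n x%:P)`_m.

Lemma coef_lag k n m x :
  (lagged G k n x%:P)`_m = if (k <= n)%N then moment_gf (n - k) m x else 0.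
Proof. by rewrite /lagged; case: ifP => // _; rewrite coef0. Qed.

Lemma moment_gf_0 m x : moment_gf 0 m x = (m == 0)%:R.
Proof. by rewrite /moment_gf /gf1 gf3_0 coef1. Qed.

Lemma moment_gf_recl n m x :
  moment_gf n.+1 m x = (a * x + b) *
    (moment_gf n m (x + b)
     + (a * (x + b) + b) * (a * b) *
       ((if m is m'.+1 then (lagged G 2 n (x + b + b)%:P)`_m' else 0)
        + a * b * (if m is m'.+2 then (lagged G 3 n (x + b + b)%:P)`_m' else 0))
     + (a * b) ^+ 2 * (if m is m'.+1 then (lagged G 2 n (x + b)%:P)`_m' else 0)).
Proof.
rewrite /moment_gf gf1_recl -!polyCD.
set L := lagged _ 2 _ (x + b + b)%:P; set L' := lagged _ 3 _ _.
set M := lagged _ 2 _ (x + b)%:P.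
rewrite (_ : (a%:P * x%:P + b%:P) * _ = (a * x + b)%:P * (G n (x + b)%:P
    + ((a * (x + b) + b) * (a * b))%:P * (L * 'X + (a * b)%:P * (L' * 'X * 'X))
    + ((a * b) ^+ 2)%:P * (M * 'X))); last first.
  by rewrite expr2 !(polyCD, polyCM); ring.
rewrite !(coefCM, coefD, coefMX).
by case: m => [|[|m]] //=.
Qed.
End Moments.

(** * Normalized binomial moments *)

Section NormalizedMoments.
Variables (R : realFieldType) (a b : R).
Hypotheses (a_gt0 : 0 < a) (b_gt0 : 0 < b).
Local Notation M := (moment_gf a b).

(* The row weight [x] for which [a * x + b = a * b * (u - n + 1)]. In terms of
   [u], the total weight of the tableaux of size [n] is a falling factorial. *)
Definition row_of n (u : R) : R := b * (u - n%:R + 1) - b / a.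

Definition moment n m u : R := M n m (row_of n u) / M n 0 (row_of n u).

Local Notation Z n u := (M n 0 (row_of n u)).

Lemma row_ofE n u : a * row_of n u + b = a * b * (u - n%:R + 1).
Proof. by rewrite /row_of; field; rewrite gt_eqF. Qed.

(** Hence the shift by [b] that accompanies a decrease of the size by one keeps [u] fixed. *)
Lemma row_ofS n u : row_of n.+1 u + b = row_of n u.
Proof. by rewrite /row_of -natr1; ring. Qed.

Lemma row_ofSS n k u : row_of (n + k) u = row_of n (u - k%:R).
Proof. by rewrite /row_of natrD; ring. Qed.

Lemma total0 u : Z 0 u = 1.
Proof. by rewrite moment_gf_0. Qed.

Lemma totalS n u : Z n.+1 u = a * b * (u - n%:R) * Z n u.
Proof.
rewrite moment_gf_recl row_ofE row_ofS !mulr0 add0r !mulr0 !addr0 -natr1.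
by congr (_ * _ * _); ring.
Qed.

(** Peels the largest factor of the falling factorial, where [totalS] peels the smallest; comparing
    totals at different [u] takes both. *)
Lemma totalS_last n u : Z n.+1 u = a * b * u * Z n (u - 1).
Proof.
elim: n u => [|n IH] u; first by rewrite totalS !total0 subr0.
by rewrite totalS IH [in RHS]totalS -natr1; ring.
Qed.

Lemma total_gt0 n u : n%:R < u + 1 -> 0 < Z n u.
Proof.
elim: n => [|n IH] nu; first by rewrite total0.
rewrite -natr1 in nu; rewrite totalS !mulr_gt0 //; last by apply: IH; lra.
by rewrite subr_gt0; lra.
Qed.

Lemma moment_n0 n u : n%:R < u + 1 -> moment n 0 u = 1.
Proof. by move=> nu; rewrite /moment divff ?gt_eqF ?total_gt0. Qed.

Lemma moment_0S m u : moment 0 m.+1 u = 0.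
Proof. by rewrite /moment !moment_gf_0 mul0r. Qed.

(** In each ratio of totals the falling factorials cancel up to their top one or two factors, and so
    do the powers of [a * b]. *)
Lemma moment_recl n m u : n%:R < u ->
  moment n.+1 m.+1 u = moment n m.+1 u
    + (lagged (moment^~ m) 2 n (u - 1)
       + lagged (moment^~ m) 2 n (u - 2) / (u - 1)) / u
    + (if m is m'.+1 then lagged (moment^~ m') 3 n (u - 2) else 0) / (u * (u - 1)).
Proof.
move=> nu; have u_gt0 : 0 < u by rewrite (le_lt_trans _ nu).
have Zn : Z n u != 0 by rewrite gt_eqF // total_gt0 //; lra.
have [a_neq0 b_neq0] : a != 0 /\ b != 0 by rewrite !gt_eqF.
have un : u - n%:R != 0 by rewrite gt_eqF // subr_gt0.
rewrite {1 2}/moment moment_gf_recl totalS row_ofE row_ofS.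
rewrite -natr1 (_ : u - (n%:R + 1) + 1 = u - n%:R); last by ring.
rewrite -addrA mulrDr mulrDl -[RHS]addrA; congr (_ + _).
  by field; rewrite Zn un a_neq0 b_neq0.
(* For sizes 0 and 1 every lagged term is 0. *)
case: n nu Zn un => [|[|n]] nu Zn un.
- by case: m => [|m]; rewrite /lagged /= ?coef0; ring.
- by case: m => [|m]; rewrite /lagged /= ?coef0; ring.
have n0 : 0 <= n%:R :> R by [].
rewrite -!natr1 in nu un.
have u1 : u - 1 != 0 by rewrite gt_eqF //; lra.
rewrite row_ofS row_ofE !coef_lag.
rewrite (_ : (n.+2 - 2)%N = n) /=; last by lia.
have r1 : row_of n.+1 u = row_of n (u - 1) by rewrite -addn1 row_ofSS.
have r2 : row_of n.+2 u = row_of n (u - 2) by rewrite -addn2 row_ofSS.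
have Z2 : Z n.+2 u = (a * b) ^+ 2 * u * (u - 1) * Z n (u - 2).
  by rewrite 2!totalS_last (_ : u - 1 - 1 = u - 2); ring.
have Z1 : Z n.+2 u = a * b * (u - n%:R - 1) * (a * b) * u * Z n (u - 1).
  by rewrite totalS totalS_last -natr1; ring.
have Zn1 : Z n (u - 1) != 0 by rewrite gt_eqF // total_gt0 //; lra.
have Zn2 : Z n (u - 2) != 0 by rewrite gt_eqF // total_gt0 //; lra.
have E1 : M n m (row_of n.+1 u) = moment n m (u - 1) * Z n (u - 1).
  by rewrite /moment r1 divfK.
have E2 : M n m (row_of n.+2 u) = moment n m (u - 2) * Z n (u - 2).
  by rewrite /moment r2 divfK.
have E3 k : (if (2 < n.+2)%N then M (n.+2 - 3) k (row_of n.+1 u) else 0) =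
    lagged (moment^~ k) 3 n.+2 (u - 2) * (Z n (u - 1) / (a * b * (u - 1))).
  rewrite /lagged; case: n n0 nu Zn un r1 r2 Z2 Z1 Zn1 Zn2 E1 E2 => [|n] *.
    by rewrite mul0r.
  rewrite /= !subSS subn0 totalS_last (_ : u - 1 - 1 = u - 2); last by ring.
  have -> : row_of n.+2 u = row_of n (u - 2) by rewrite -addn2 row_ofSS.
  have : Z n (u - 2) != 0 by rewrite gt_eqF // total_gt0 //; lra.
  rewrite /moment => Zk; by field; rewrite ?Zk ?a_neq0 ?b_neq0 ?u1.
have uu : u - n%:R - 1 != 0 by rewrite gt_eqF //; lra.
(* Equating the two expressions for [Z n.+2 u] leaves [Z n (u - 1)] as the only total. *)
have Z12 : Z n (u - 2) = (u - n%:R - 1) * Z n (u - 1) / (u - 1).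
  apply: (mulfI (mulf_neq0 (mulf_neq0 a_neq0 b_neq0) u1)).
  apply: (mulfI (mulf_neq0 (mulf_neq0 a_neq0 b_neq0) (lt0r_neq0 u_gt0))).
  have := etrans (esym Z2) Z1.
  move=> H; apply: etrans (etrans _ H) _; first by ring.
  by field; rewrite u1.
have lag2 v : lagged (moment^~ m) 2 n.+2 v = moment n m v.
  by rewrite /lagged (_ : (n.+2 - 2)%N = n) //; lia.
rewrite E1 E2 Z12 Z1 !lag2 -(natr1 n.+1) -(natr1 n).
case: m E1 E2 lag2 => [|m] _ _ _; last rewrite coef_lag E3.
  by field; rewrite ?Zn1 ?u1 ?uu ?(lt0r_neq0 u_gt0) ?a_neq0 ?b_neq0 ?un.
by field; rewrite ?Zn1 ?u1 ?uu ?(lt0r_neq0 u_gt0) ?a_neq0 ?b_neq0 ?un.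
Qed.

End NormalizedMoments.

(** * Two-sided bounds on the normalized moments *)

Lemma expnS_le_pred A m : (A ^ m.+1 <= A.-1 ^ m.+1 + m.+1 * A ^ m)%N.
Proof.
case: A => [|A] /=; first by rewrite exp0n.
elim: m => [|m IH]; first by rewrite !expn1 expn0 muln1 addn1.
have H : (A ^ m.+1 <= A.+1 ^ m.+1)%N by rewrite leq_exp2r.
rewrite expnS [(A ^ m.+2)%N]expnS (leq_trans (leq_mul (leqnn A.+1) IH)) //.
rewrite mulnDr [(A.+1 * (_ * _))%N]mulnCA -expnS.
by move: (A ^ m.+1)%N (A.+1 ^ m.+1)%N H => p q; nia.
Qed.

(** The binomial theorem cut after two terms. With the preceding inequality it plays the role of a
    mean value theorem for powers: one drives the induction on the size in [moment_ge], the other in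
    [moment_le]. *)
Lemma expn_addS_le n m : (n ^ m.+1 + m.+1 * n ^ m <= n.+1 ^ m.+1)%N.
Proof.
elim: m => [|m IH]; first by rewrite !expn1 expn0 muln1 addn1.
rewrite [leqRHS]expnS (leq_trans _ (leq_mul (leqnn n.+1) IH)) //.
by rewrite !expnS; move: (n ^ m)%N => p; nia.
Qed.

Section MomentBounds.
Variables (R : realFieldType) (a b : R).
Hypotheses (a_gt0 : 0 < a) (b_gt0 : 0 < b).
Local Notation moment := (moment a b).

Lemma lagged_ge0 (f : nat -> R -> R) k n u :
  ((k <= n)%N -> 0 <= f (n - k)%N u) -> 0 <= lagged f k n u.
Proof. by rewrite /lagged; case: ifP => // _; apply. Qed.

(** Strong induction, as the recurrence reaches back four sizes; [n < u + 1] passes to every lagged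
    term. *)
Lemma moment_ge0 n m u : n%:R < u + 1 -> 0 <= moment n m u.
Proof.
have [k] := ubnP n; elim: k => // k IH in n m u *.
case: m => [|m]; first by move=> _ nu; rewrite moment_n0.
case: n => [|n]; first by rewrite moment_0S.
rewrite ltnS -natr1 => nk nu; have nu' : n%:R < u by lra.
have n0 : 0 <= n%:R :> R by [].
rewrite moment_recl // !addr_ge0 //.
- by apply: IH => //; lra.
- apply: divr_ge0; last by lra.
  apply: addr_ge0; first by apply: lagged_ge0 => kn; apply: IH; [lia|rewrite natrB //; lra].
  rewrite /lagged; case: ifP; last by rewrite mul0r.
  move=> kn; have n2 : 2 <= n%:R :> R by rewrite ler_nat.
  apply: divr_ge0; last by lra.
  by apply: IH; [lia|rewrite natrB //; lra].
- case: m => [|m]; first by rewrite mul0r.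
  rewrite /lagged; case: ifP; last by rewrite mul0r.
  move=> kn; have n3 : 3 <= n%:R :> R by rewrite ler_nat.
  apply: divr_ge0; last by apply: mulr_ge0; lra.
  by apply: IH; [lia|rewrite natrB //; lra].
Qed.

(** Only the first lagged term is kept. It links size [n.+1] at order [m.+1] with size [n - 2] at
    order [m], so each order costs three sizes. *)
Lemma moment_ge n m u : n%:R < u + 1 -> 0 < u ->
  ((n - 3 * m) ^ m)%:R / (m`!%:R * u ^+ m) <= moment n m u.
Proof.
elim: m n u => [|m IHm] n u nu u0; first by rewrite moment_n0 // fact0 expn0 expr0 mulr1 divr1.
elim: n nu => [|n IHn] nu; first by rewrite exp0n // mul0r moment_0S.
rewrite -natr1 in nu; have nu' : n%:R < u by lra.
have n0 : 0 <= n%:R :> R by [].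
have [n2|n2] := ltnP n 2.
  rewrite (_ : (n.+1 - _)%N = 0%N); last by lia.
  rewrite exp0n // mul0r.
  by apply: moment_ge0; rewrite -natr1; lra.
have n2R : 2 <= n%:R :> R by rewrite ler_nat.
have nB : (n - 2)%:R = n%:R - 2 :> R by rewrite natrB.
set A := (n - 2 - 3 * m)%N.
have -> : (n.+1 - 3 * m.+1)%N = A by rewrite /A; lia.
have AE : (n - 3 * m.+1)%N = A.-1 by rewrite /A; lia.
rewrite AE in IHn.
apply: (@le_trans _ _ (moment n m.+1 u + moment (n - 2) m (u - 1) / u)); last first.
  rewrite moment_recl // -!addrA lerD2l mulrDl -!addrA {1}/lagged n2 lerDl.
  apply: addr_ge0.
    rewrite !divr_ge0 //; try lra.
    by apply: lagged_ge0 => _; apply: moment_ge0; lra.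
  apply: divr_ge0; last by rewrite mulr_ge0 //; lra.
  case: (m) => // m'; apply: lagged_ge0 => n3; apply: moment_ge0.
  by rewrite natrB //; lra.
have u1 : 0 < u - 1 by lra.
(* Enlarging [u - 1] to [u] in the denominator only lowers the bound. *)
have IH1 : (A ^ m)%:R / (m`!%:R * u ^+ m) <= moment (n - 2) m (u - 1).
  apply: le_trans (IHm _ _ _ u1); last by lra.
  apply: ler_wpM2l => //; rewrite lef_pV2 ?posrE ?mulr_gt0 ?exprn_gt0 ?ltr0n ?fact_gt0 //.
  rewrite ler_pM2l ?ltr0n ?fact_gt0 //; apply: lerXn2r; rewrite ?nnegrE; lra.
apply: (@le_trans _ _ ((A.-1 ^ m.+1)%:R / (m.+1`!%:R * u ^+ m.+1)
     + (A ^ m)%:R / (m`!%:R * u ^+ m) / u)); last first.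
  by apply: lerD; [apply: IHn; lra|rewrite ler_pM2r ?invr_gt0].
have -> : (A ^ m)%:R / (m`!%:R * u ^+ m) / u =
    (m.+1 * A ^ m)%:R / (m.+1`!%:R * u ^+ m.+1) :> R.
  rewrite factS !natrM exprS; field.
  by rewrite nat1r expf_neq0 ?(lt0r_neq0 u0) // !pnatr_eq0 -lt0n fact_gt0.
rewrite -mulrDl -natrD ler_wpM2r ?ler_nat ?expnS_le_pred //.
by rewrite invr_ge0 mulr_ge0 ?exprn_ge0 // ltW.
Qed.

(** The error term grows by [K / u ^+ 2] with each size, enough to absorb the lower-order
    contributions of one recurrence step. *)
Lemma moment_le m : exists2 K, 0 <= K & forall n u, n%:R < u + 1 -> 0 < u ->
  moment n m u <= n%:R ^+ m / (m`!%:R * u ^+ m) + K * n%:R / u ^+ 2.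
Proof.
(* The recurrence at order [m.+1] involves order [m.-1] as well, so a uniform bound for it is
   carried along. *)
suff: (exists2 K, 0 <= K & forall n u, n%:R < u + 1 -> 0 < u ->
    moment n m u <= n%:R ^+ m / (m`!%:R * u ^+ m) + K * n%:R / u ^+ 2) /\
  (exists2 K, 0 <= K & forall n u, n%:R < u -> moment n m.-1 u <= 1 + K) by case.
have crude k : (exists2 K, 0 <= K & forall n u, n%:R < u + 1 -> 0 < u ->
    moment n k u <= n%:R ^+ k / (k`!%:R * u ^+ k) + K * n%:R / u ^+ 2) ->
    exists2 K, 0 <= K & forall n u, n%:R < u -> moment n k u <= 1 + K.
  case=> K K0 H; exists K => // n u nu.
  have n0 : 0 <= n%:R :> R by [].
  have u0 : 0 < u by lra.
  apply: le_trans (H _ _ _ u0) _; first by lra.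
  apply: lerD.
    rewrite ler_pdivrMr ?mulr_gt0 ?exprn_gt0 ?ltr0n ?fact_gt0 // mul1r.
    apply: (@le_trans _ _ (u ^+ k)); first by apply: lerXn2r; rewrite ?nnegrE; lra.
    by rewrite ler_peMl ?exprn_ge0 ?(ltW u0) // ler1n fact_gt0.
  rewrite -mulrA ler_piMr // ler_pdivrMr ?exprn_gt0 // mul1r expr2.
  case: n nu n0 {H} => [|n] nu n0; first by rewrite mulr_ge0 // ltW.
  have : 1 <= n.+1%:R :> R by rewrite ler1n.
  by nra.
elim: m => [|m [IH1 IH2]].
  have H : exists2 K, 0 <= K & forall n u, n%:R < u + 1 -> 0 < u ->
    moment n 0 u <= n%:R ^+ 0 / (0`!%:R * u ^+ 0) + K * n%:R / u ^+ 2.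
    exists 0 => // n u nu u0.
    by rewrite moment_n0 // fact0 !expr0 mulr1 divr1 !mul0r addr0.
  by split=> //; apply: crude.
have [B B0 HB] := crude _ IH1; split; last by exists B.
have {IH1}[K K0 HK] := IH1; have {IH2}[C C0 HC] := IH2.
(* The summands pay for [E1], [E2] and [E3], each with a factor 2 from [(u - 1)^-1 <= 2 / u]. *)
exists (2 * K + 2 * (1 + B) + 2 * (1 + C)); first by lra.
set D := 2 * K + _ + _.
elim=> [|n IHn] u nu u0.
  by rewrite moment_0S expr0n /= !mul0r mulr0 mul0r addr0.
rewrite -natr1 in nu; have nu' : n%:R < u by lra.
have n0 : 0 <= n%:R :> R by [].
apply: (@le_trans _ _ (n%:R ^+ m.+1 / (m.+1`!%:R * u ^+ m.+1) + D * n%:R / u ^+ 2 +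
   (n%:R ^+ m / (m`!%:R * u ^+ m) / u + D / u ^+ 2))); last first.
  rewrite (_ : _ / _ / u = (m.+1 * n ^ m)%:R / (m.+1`!%:R * u ^+ m.+1)); last first.
    rewrite factS !natrM natrX exprS; field.
    by rewrite nat1r expf_neq0 ?(lt0r_neq0 u0) // !pnatr_eq0 -lt0n fact_gt0.
  rewrite addrACA -mulrDl -natrX -natrD -natr1 mulrDr mulr1 [_ / u ^+ 2 + _]addrC.
  rewrite -mulrDl [D + _]addrC lerD2r natr1 -natrX ler_wpM2r ?ler_nat ?expn_addS_le //.
  by rewrite invr_ge0 mulr_ge0 ?exprn_ge0 // ltW.
have u2 : 0 < u ^+ 2 by rewrite exprn_gt0.
rewrite moment_recl // -addrA lerD ?IHn //; first by lra.
have T0 : 0 <= n%:R ^+ m / (m`!%:R * u ^+ m) / u + D / u ^+ 2.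
  rewrite addr_ge0 // divr_ge0 ?mulr_ge0 ?exprn_ge0 ?invr_ge0 ?mulr_ge0 ?exprn_ge0 //; rewrite /D; lra.
have [n2|n2] := ltnP n 2.
  rewrite /lagged !(ltn_geF n2) (ltn_geF (leq_trans n2 _)) //.
  by case: (m) T0 => [|m'] T0; rewrite !(mul0r, addr0).
have n2R : 2 <= n%:R :> R by rewrite ler_nat.
have nB : (n - 2)%:R = n%:R - 2 :> R by rewrite natrB.
have u1 : 0 < u - 1 by lra.
have iu : (u - 1)^-1 <= 2 / u by rewrite ler_pdivlMr // ler_pdivrMl //; lra.
have iu0 : 0 < u^-1 by rewrite invr_gt0.
have E1 : lagged (moment^~ m) 2 n (u - 1) <= n%:R ^+ m / (m`!%:R * u ^+ m) + 2 * K / u.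
  rewrite /lagged n2; apply: le_trans (HK _ _ _ u1) _; first by lra.
  apply: lerD.
    have powE (x v : R) : x ^+ m / (m`!%:R * v ^+ m) = m`!%:R^-1 * (x / v) ^+ m.
      by rewrite expr_div_n invfM mulrCA.
    rewrite !powE nB ler_wpM2l ?invr_ge0 //; apply: lerXn2r.
    - by rewrite nnegrE divr_ge0 //; lra.
    - by rewrite nnegrE divr_ge0 //; lra.
    by rewrite ler_pdivrMr // mulrAC ler_pdivlMr //; nra.
  rewrite nB -mulrA [2 * K]mulrC -mulrA ler_wpM2l //.
  apply: le_trans iu; rewrite ler_pdivrMr ?exprn_gt0 // expr2 mulKf ?lt0r_neq0 //; lra.
have E2 : lagged (moment^~ m) 2 n (u - 2) / (u - 1) <= 2 * (1 + B) / u.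
  rewrite mulrAC [2 / u * _]mulrC; apply: ler_pM => //.
  - by rewrite /lagged n2 moment_ge0 // nB; lra.
  - by rewrite invr_ge0 ltW.
  - by rewrite /lagged n2 HB // nB; lra.
have E3 : (if m is m'.+1 then lagged (moment^~ m') 3 n (u - 2) else 0) / (u * (u - 1))
    <= 2 * (1 + C) / u ^+ 2.
  have -> : 2 * (1 + C) / u ^+ 2 = (1 + C) * (u^-1 * (2 / u)).
    by field; rewrite lt0r_neq0.
  rewrite invfM; apply: (@le_trans _ _ ((1 + C) * (u^-1 / (u - 1)))).
    rewrite ler_wpM2r ?mulr_ge0 ?invr_ge0 ?(ltW u0) ?(ltW u1) //.
    case: (m) HC => [|m'] HC; first by lra.
    rewrite /lagged; case: ifP => n3; last by lra.
    by apply: HC; rewrite natrB //; lra.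
  by rewrite ler_wpM2l ?ler_wpM2l //; lra.
apply: le_trans (lerD (ler_wpM2r (ltW iu0) (lerD E1 E2)) E3) _.
rewrite le_eqVlt; apply/orP; left; apply/eqP; rewrite /D; field.
by rewrite expf_neq0 ?(lt0r_neq0 u0) // pnatr_eq0 -lt0n fact_gt0.
Qed.
End MomentBounds.

(** * Bonferroni inequalities *)

Lemma tableau_weightE (K : comNzRingType) (a b y : K) n (S : filling n) :
  tableau_weight a b y S = a ^+ N_alpha S * b ^+ N_beta S * y ^+ X3 S.
Proof.
rewrite /tableau_weight pair_big /= -!prodr_const.
rewrite [X in X * _ * _]big_mkcond [X in _ * X * _]big_mkcond [X in _ * X]big_mkcond.
rewrite -!big_split; apply: eq_bigr => -[i j] _ /=; rewrite !inE /box_weight.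
by case: (S (i, j)) => [[]|] /=; rewrite ?eqxx ?andbT ?andbF ?mul1r ?mulr1.
Qed.

Lemma coef_1DXn (R : nzRingType) k m : ((1 + 'X) ^+ k : {poly R})`_m = 'C(k, m)%:R.
Proof.
elim: k m => [|k IH] m; first by rewrite expr0 coef1 bin0n.
rewrite exprSr mulrDr mulr1 coefD coefMX IH; case: m => [|m]; first by rewrite addr0 !bin0.
by rewrite IH binS natrD addrC.
Qed.

Lemma moment_gf1 (R : fieldType) (a b : R) n m :
  moment_gf a b n m 1 = \sum_(S in staircases n) (a ^+ N_alpha S * b ^+ N_beta S) * 'C(X3 S, m)%:R.
Proof.
rewrite /moment_gf /gf1 /gf3 /gf coef_sum; apply: eq_bigr => S _.
rewrite /row_weight big1 => [|i _]; last by case: ifP => // _; case: (_ - _)%N => [|[|?]].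
by rewrite mulr1 tableau_weightE -!polyC_exp -polyCM coefCM coef_1DXn.
Qed.

(** This value of [u] solves [row_of a b n u = 1], where all row weights become 1. *)
Lemma binomial_moment (R : realFieldType) (a b : R) n m : 0 < a -> 0 < b ->
  \sum_(S in staircases n) prob a b S * 'C(X3 S, m)%:R
  = moment a b n m (n%:R + (a^-1 + b^-1 - 1)).
Proof.
move=> a0 b0; rewrite /moment.
have -> : row_of a b n (n%:R + (a^-1 + b^-1 - 1)) = 1.
  by rewrite /row_of; field; rewrite !gt_eqF.
rewrite !moment_gf1 mulr_suml; apply: eq_bigr => S _; rewrite /prob mulrAC.
by congr (_ / _); apply: eq_bigr => T _; rewrite bin0 mulr1.
Qed.

(** Both sides equal [x! / (j! i! (x - j - i)!)] if [j + i <= x], and 0 otherwise. *)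
Lemma mul_bin_bin x j i : ('C(j + i, j) * 'C(x, j + i) = 'C(x, j) * 'C(x - j, i))%N.
Proof.
have [xji|xji] := ltnP x (j + i).
  rewrite (bin_small xji) muln0; have [xj|jx] := ltnP x j; first by rewrite bin_small.
  by rewrite [X in (_ * X)%N]bin_small ?muln0 //; lia.
have f0 : (0 < j`! * i`! * (x - (j + i))`!)%N by rewrite !muln_gt0 !fact_gt0.
apply/eqP; rewrite -(eqn_pmul2r f0); apply/eqP.
have B1 := bin_fact xji; have B2 := bin_fact (leq_addr i j).
have B3 : ('C(x, j) * (j`! * (x - j)`!) = x`!)%N by apply: bin_fact; lia.
have B4 : ('C(x - j, i) * (i`! * (x - j - i)`!) = (x - j)`!)%N by apply: bin_fact; lia.
rewrite addKn in B2; rewrite -subnDA in B4.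
transitivity (x`!); first by rewrite -B1 -B2; lia.
by rewrite -B3 -B4; lia.
Qed.

Section Bonferroni.
Variable R : realFieldType.

Lemma alternating_bin d L :
  \sum_(i < L.+1) (- 1) ^+ i * 'C(d.+1, i)%:R = (- 1) ^+ L * 'C(d, L)%:R :> R.
Proof.
elim: L => [|L IH]; first by rewrite big_ord1 !bin0.
by rewrite big_ord_recr /= IH binS natrD exprS; ring.
Qed.

(** The full alternating sum is [(1 - 1)^d]; [alternating_bin] evaluates the truncated one, and
    Pascal's rule bounds the error by the first omitted binomial. *)
Lemma bonferroni0 d L :
  `|(d == 0%N)%:R - \sum_(i < L) (- 1) ^+ i * 'C(d, i)%:R| <= 'C(d, L)%:R :> R.
Proof.
case: d L => [|d] [|L].
- by rewrite big_ord0 subr0 normr1 bin0.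
- rewrite big_ord_recl big1 /= => [|i _]; last by rewrite bin0n mulr0.
  by rewrite bin0 mulr1 addr0 subrr normr0.
- by rewrite big_ord0 subr0 normr0.
- rewrite alternating_bin sub0r normrN normrM normrX normrN1 expr1n mul1r normr_nat.
  by rewrite ler_nat binS leq_addl.
Qed.

(** Factoring out ['C(x, j)] reduces this to [bonferroni0] at [x - j]; the factor vanishes for
    [x < j], where the truncated difference is 0. *)
Lemma bonferroni x j L :
  `|(x == j)%:R - \sum_(i < L) (- 1) ^+ i * 'C(j + i, j)%:R * 'C(x, j + i)%:R|
  <= 'C(j + L, j)%:R * 'C(x, j + L)%:R :> R.
Proof.
have E i : 'C(j + i, j)%:R * 'C(x, j + i)%:R = 'C(x, j)%:R * 'C(x - j, i)%:R :> R.
  by rewrite -!natrM mul_bin_bin.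
under eq_bigr => i _ do rewrite -mulrA E mulrCA.
rewrite -mulr_sumr E.
have -> : (x == j)%:R = 'C(x, j)%:R * (x - j == 0)%N%:R :> R.
  rewrite subn_eq0; have [xj|jx|->] := ltngtP x j; last by rewrite binn mulr1.
    by rewrite bin_small // mul0r.
  by rewrite mulr0.
by rewrite -mulrBr normrM normr_nat ler_wpM2l // bonferroni0.
Qed.

Lemma bonferroni_sum (I : finType) (A : {set I}) (p : I -> R) (X : I -> nat) j L :
  (forall i, i \in A -> 0 <= p i) ->
  `|\sum_(s in A | X s == j) p s -
    \sum_(i < L) (- 1) ^+ i * 'C(j + i, j)%:R * \sum_(s in A) p s * 'C(X s, j + i)%:R|
  <= 'C(j + L, j)%:R * \sum_(s in A) p s * 'C(X s, j + L)%:R.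
Proof.
move=> p0; have -> : \sum_(s in A | X s == j) p s = \sum_(s in A) p s * (X s == j)%:R.
  by rewrite big_mkcondr; apply: eq_bigr => s _; case: eqP; rewrite ?mulr1 ?mulr0.
have -> : \sum_(i < L) (- 1) ^+ i * 'C(j + i, j)%:R * \sum_(s in A) p s * 'C(X s, j + i)%:R
    = \sum_(s in A) p s * \sum_(i < L) (- 1) ^+ i * 'C(j + i, j)%:R * 'C(X s, j + i)%:R.
  under [RHS]eq_bigr => s _ do rewrite mulr_sumr.
  rewrite exchange_big; apply: eq_bigr => i _; rewrite mulr_sumr.
  by apply: eq_bigr => s _; rewrite mulrCA.
rewrite -sumrB mulr_sumr; apply: le_trans (ler_norm_sum _ _ _) _.
apply: ler_sum => s sA; rewrite -mulrBr normrM (ger0_norm (p0 s sA)) [leRHS]mulrCA.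
by apply: ler_wpM2l; [exact: p0|exact: bonferroni].
Qed.
End Bonferroni.

(** * Limits *)

Section Limits.
Variable R : realType.

Lemma cvg_inv_shift (t : R) : (n%:R + t)^-1 @[n --> \oo] --> 0.
Proof.
apply/gtr0_cvgV0; last first.
  apply/cvgryPge => A; have [N _ HN] := nbhs_infty_ger (A - t).
  by exists N => // n /HN /=; rewrite lerBlDr.
have [N _ HN] := nbhs_infty_ger (1 - t).
by exists N => // n /HN /=; rewrite lerBlDr; apply: lt_le_trans.
Qed.

Lemma cvg_ratio_shift (c : nat) (t : R) : (n - c)%:R / (n%:R + t) @[n --> \oo] --> (1 : R).
Proof.
have H : 1 - (c%:R + t) * (n%:R + t)^-1 @[n --> \oo] --> (1 - (c%:R + t) * 0 : R).
  apply: cvgB; first exact: cvg_cst.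
  by apply: cvgM; [exact: cvg_cst|exact: cvg_inv_shift].
(* Once [n >= c] the truncated difference is exact and the ratio equals [1 - (c + t) / (n + t)]. *)
rewrite mulr0 subr0 in H; apply: cvg_trans H; apply: near_eq_cvg.
have [N _ HN] := nbhs_infty_ger (1 - t).
exists (maxn N c) => // n /=; rewrite geq_max => /andP[Nn cn].
have := HN n Nn; rewrite /= lerBlDr => tn.
rewrite natrB //; field; lra.
Qed.

Lemma moment_cvg (a b : R) m : 0 < a -> 0 < b ->
  moment a b n m (n%:R + (a^-1 + b^-1 - 1)) @[n --> \oo] --> (m`!%:R^-1 : R).
Proof.
move=> a0 b0; set t := _ - 1.
have t1 : 0 < t + 1 by rewrite /t subrK addr_gt0 ?invr_gt0.
have [K K0 HK] := moment_le a0 b0 m.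
(* These are the bounds of [moment_ge] and [moment_le] at [u = n + t], which is positive for
   [n >= 1] because [t > -1]. *)
apply: (@squeeze_cvgr _ _ _ _
  (fun n => m`!%:R^-1 * ((n - 3 * m)%:R / (n%:R + t)) ^+ m)
  (fun n => m`!%:R^-1 * ((n - 0)%:R / (n%:R + t)) ^+ m
            + K * (((n - 0)%:R / (n%:R + t)) * (n%:R + t)^-1))).
- exists 1%N => // n /= n1; have n1R : 1 <= n%:R :> R by rewrite ler1n.
  have u0 : 0 < n%:R + t by lra.
  apply/andP; split.
    rewrite expr_div_n mulrCA -invfM -natrX.
    by apply: moment_ge => //; lra.
  apply: le_trans (HK _ _ _ u0) _; first by lra.
  by rewrite subn0 expr_div_n mulrCA -invfM lerD2l expr2 invfM !mulrA.
- have {2}-> : m`!%:R^-1 = m`!%:R^-1 * 1 ^+ m :> R by rewrite expr1n mulr1.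
  apply: cvgM; first exact: cvg_cst.
  exact: cvg_comp (cvg_ratio_shift _ _) (@exprn_continuous _ m 1).
- have {2}-> : m`!%:R^-1 = m`!%:R^-1 * 1 ^+ m + K * (1 * 0) :> R.
    by rewrite expr1n !mulr1 mul1r mulr0 addr0.
  apply: cvgD.
    apply: cvgM; first exact: cvg_cst.
    exact: cvg_comp (cvg_ratio_shift _ _) (@exprn_continuous _ m 1).
  apply: cvgM; first exact: cvg_cst.
  by apply: cvgM; [exact: cvg_ratio_shift|exact: cvg_inv_shift].
Qed.

Lemma cvg_sum_ord (f : nat -> nat -> R) (l : nat -> R) L :
  (forall i, f n i @[n --> \oo] --> l i) ->
  \sum_(i < L) f n i @[n --> \oo] --> \sum_(i < L) l i.
Proof.
by move=> fl; apply: cvg_big => // x; exact: add_continuous.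
Qed.

Lemma bin_fact_inv j i : 'C(j + i, j)%:R / (j + i)`!%:R = j`!%:R^-1 * i`!%:R^-1 :> R.
Proof.
have := bin_fact (leq_addr i j); rewrite addKn => <-.
rewrite !natrM; field.
by rewrite !pnatr_eq0 -!lt0n !fact_gt0 bin_gt0 leq_addr.
Qed.

Lemma X3_pmf_cvg (a b : R) j : 0 < a -> 0 < b ->
  \sum_(S in staircases n | X3 S == j) prob a b S @[n --> \oo]
    --> (expR (-1) / j`!%:R : R).
Proof.
move=> a0 b0.
pose t : R := a^-1 + b^-1 - 1.
pose mu m n := moment a b n m (n%:R + t).
pose s L : R := \sum_(i < L) (- 1) ^+ i * 'C(j + i, j)%:R * (j + i)`!%:R^-1.
pose T L n : R := \sum_(i < L) (- 1) ^+ i * 'C(j + i, j)%:R * mu (j + i)%N n.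
have bonf L n : `|\sum_(S in staircases n | X3 S == j) prob a b S - T L n|
    <= 'C(j + L, j)%:R * mu (j + L)%N n.
  rewrite /T /mu /t; under [X in _ - X]eq_bigr => i _ do rewrite -binomial_moment //.
  rewrite -binomial_moment //; apply: bonferroni_sum => S _.
  by rewrite divr_ge0 ?sumr_ge0 // => *; rewrite mulr_ge0 ?exprn_ge0 // ltW.
have s_cvg : s L @[L --> \oo] --> expR (-1) / j`!%:R.
  have -> : s = fun L => series (exp_coeff (-1)) L / j`!%:R.
    apply/funext => L; rewrite /series /= big_mkord mulr_suml; apply: eq_bigr => i _.
    by rewrite -mulrA bin_fact_inv /exp_coeff /=; ring.
  by apply: cvgMl; exact: is_cvg_series_exp_coeff.
have d_cvg : 'C(j + L, j)%:R * (j + L)`!%:R^-1 @[L --> \oo] --> (0 : R).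
  under eq_fun do rewrite bin_fact_inv.
  rewrite -(mulr0 (j`!%:R^-1)); apply: cvgM; first exact: cvg_cst.
  rewrite (_ : (fun L => _) = exp_coeff (1 : R)); first exact: cvg_exp_coeff.
  by apply/funext => L; rewrite /exp_coeff /= expr1n mul1r.
(* Four errors of [e / 4]: the tail of the exponential series and the limiting Bonferroni remainder,
   made small by [L]; then, for that fixed [L], the convergence in [n] of the truncated sum and of
   the remainder. *)
apply/cvgrPdist_le => e e0; have e4 : 0 < e / 4 by rewrite divr_gt0.
near \oo => L.
have sL : `|expR (-1) / j`!%:R - s L| < e / 4 by near: L; exact: cvgr_dist_lt.
have dL : `|0 - 'C(j + L, j)%:R * (j + L)`!%:R^-1| < e / 4.
  by near: L; exact: cvgr_dist_lt.
have T_cvg : T L n @[n --> \oo] --> s L.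
  apply: (@cvg_sum_ord (fun n i => (- 1) ^+ i * 'C(j + i, j)%:R * mu (j + i)%N n)
    (fun i => (- 1) ^+ i * 'C(j + i, j)%:R * (j + i)`!%:R^-1)) => i.
  by apply: cvgM; [exact: cvg_cst|exact: moment_cvg].
have E_cvg : 'C(j + L, j)%:R * mu (j + L)%N n @[n --> \oo]
    --> ('C(j + L, j)%:R * (j + L)`!%:R^-1 : R).
  by apply: cvgM; [exact: cvg_cst|exact: moment_cvg].
near=> n.
have H1 : `|s L - T L n| < e / 4 by near: n; exact: cvgr_dist_lt.
have H2 : `|'C(j + L, j)%:R * (j + L)`!%:R^-1 - 'C(j + L, j)%:R * mu (j + L)%N n| < e / 4.
  by near: n; exact: cvgr_dist_lt.
have := bonf L n; move: sL dL H1 H2.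
set p := \sum_(_ in _ | _) _; set l := _ / _; set d := _ * _^-1; set q := _ * mu _ _.
rewrite ler_norml !ltr_norml ler_norml => /andP[? ?] /andP[? ?] /andP[? ?] /andP[? ?] /andP[? ?].
by apply/andP; split; lra.
Unshelve. all: by end_near.
Qed.
End Limits.

(* Convergence in distribution of the N-valued X_n^(3) to Poisson(1):
   the distribution functions converge at every continuity point of the
   Poisson(1) cdf, i.e. for every x in [k, k+1) (k : nat);
   P(X <= x) = P(X <= k) there. (For x < 0 both sides are 0.) *)
Theorem theorem4p6 (R : realType) (a b : R) (ha : 0 < a) (hb : 0 < b)
  (k : nat) :
  (fun n : nat => cdf_X3 a b k n) @ \oo -->
    \sum_(j < k.+1) expR (-1) / (j`!)%:R.
Proof.
(* Splitting by the value of [X3] gives a finite sum, so the limit can be taken termwise. *)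
have -> : (fun n : nat => cdf_X3 a b k n) =
    (fun n => \sum_(j < k.+1) \sum_(S in staircases n | X3 S == j) prob a b S).
  apply/funext => n; under [RHS]eq_bigr => j _ do rewrite big_mkcondr.
  rewrite exchange_big /cdf_X3 big_mkcondr; apply: eq_bigr => S _.
  rewrite -big_mkcond /=; case: leqP => [Xk|kX].
    by rewrite (big_pred1 (Ordinal (Xk : (X3 S < k.+1)%N))).
  by rewrite big_pred0 // => j; rewrite gtn_eqF // (leq_trans _ kX).
apply: (@cvg_sum_ord R (fun n j => \sum_(S in staircases n | X3 S == j) prob a b S)
  (fun j => expR (-1) / j`!%:R)) => j.
exact: X3_pmf_cvg.
Qed.
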